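(* Let $D=\langle t,u\rangle$ be a dihedral group of order $8$ generated by involutions $t,u$, let $f\in D$ have order $4$, and let $L$ be a free abelian group of rank $2n$ with an action of $D$ in which the central involution $[t,u]$ acts as $-1$. Let $d,e$ be the numbers of Jordan blocks of size $2$ and $1$, respectively, of $u$ acting on $L/\mathrm{Tel}(t)$. Then $$|B(t)+B(u):(L(f-1)/2\mathrm{Tel}(t))|=2^{n+3d+e-(2d+e+n)}=2^d .$$ Therefore $L(f-1)=L(t-1)+L(u-1)$ if and only if $d=0$. In other language, for the $D$-module $L$, commutator density is equivalent to $2/4$-generation.
   Context: Actions are on the right. For an involution $s$ acting on $L$ and $\varepsilon=\pm1$, $L^{\varepsilon}(s)=\{v\in L: vs=\varepsilon v\}$ and $\mathrm{Tel}(s)=L^+(s)\oplus L^-(s)$. The quotient $L/\mathrm{Tel}(t)$ is an elementary abelian $2$-group, viewed as an $\mathbb{F}_2$-space on which $u$ acts. There is a chain of $D$-invariant groups $2\mathrm{Tel}(t)\le L\le\frac12\mathrm{Tel}(t)$ inside $\mathbb{Q}\otimes L$, and $2\mathrm{Tel}(t)\le L(f-1)$. For $g\in D$, $B(g):=(L(g-1)+2\mathrm{Tel}(t))/2\mathrm{Tel}(t)$. For a $D$-module $M$ (with the central involution acting as $-1$), $[M,D]$ is the subgroup generated by all $v(g-1)$, $v\in M$, $g\in D$. Commutator density is the property $[M,D]=M(f-1)$. The $2/4$-generation property is that $M$ is generated by the fixed points of a generating pair of involutions in $D$, i.e. $M=M^+(a)+M^+(b)$ for involutions $a,b$ generating $D$.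 *)

(* Defs.v *)
From HB Require Import structures.
From mathcomp Require Import all_boot all_order all_algebra all_fingroup all_solvable.
From mathcomp Require Import all_classical.

Set Implicit Arguments.
Unset Strict Implicit.
Unset Printing Implicit Defensive.

Import GRing.Theory.
Local Open Scope ring_scope.
Local Open Scope classical_set_scope.
Local Open Scope card_scope.
Local Open Scope quotient_scope.

Section Subgroups.
Variable V : zmodType.
Implicit Types A B H K : set V.

Definition additive_subgroup A := A 0 /\ forall x y, A x -> A y -> A (x - y).

Definition spanned A : set V :=
  [set x | forall H, additive_subgroup H -> A `<=` H -> H x].

Definition sumset A B : set V := [set x + y | x in A & y in B].

Definition twice A : set V := [set x *+ 2 | x in A].

(* |K : H| = m, for subgroups H and K; the inclusion H <= K is part of the
   assertion. *)
Definition index_eq K H (m : nat) : Prop :=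
  H `<=` K /\ [set [set x + h | h in H] | x in K] #= `I_m.

Definition spanned_pred A : {pred V} := fun x => `[< spanned A x >].

Lemma spanned_zmod_closed A : zmod_closed (spanned_pred A).
Proof.
split=> [|x y /asboolP Ax /asboolP Ay]; apply/asboolP => H sH AH.
  exact: (proj1 sH).
by apply: (proj2 sH); [apply: Ax | apply: Ay].
Qed.

HB.instance Definition _ A :=
  GRing.isZmodClosed.Build V (spanned_pred A) (spanned_zmod_closed A).

Lemma spanned_id A : additive_subgroup A -> spanned A = A.
Proof.
move=> sA; apply/seteqP; split=> [x|x Ax H _]; last exact.
by move/(_ A sA); apply.
Qed.

(* The quotient group V / <A>, which is V / A when A is a subgroup. *)
Definition quotient_by A : zmodType := Quotient.quot (spanned_pred A).

Definition quotient_proj A (x : V) : quotient_by A := \pi x.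

(* The map on V / <A> induced by phi, computed on representatives; it does not
   depend on them when phi is additive and preserves <A>. *)
Definition quotient_map A (phi : V -> V) (x : quotient_by A) : quotient_by A :=
  quotient_proj A
    (phi (generic_quotient.repr (x : Quotient.quot (spanned_pred A)))).

End Subgroups.

Arguments quotient_proj {V} A x.
Arguments quotient_map {V} A phi x.

(* The Jordan block for the action on row vectors by right multiplication. *)
Definition jordan_block (F : fieldType) (a : F) (m : nat) : 'M[F]_m :=
  \matrix_(i < m, j < m) (a *+ (i == j) + (i.+1 == j :> nat)%:R).

(* phi has a Jordan form over F_2 with k blocks of sizes p i and eigenvalues
   a i. For an elementary abelian 2-group V, the additive bijections
   'rV['F_2]_m -> V are exactly the F_2-linear ones. *)
Definition has_jordan_form (V : zmodType) (phi : V -> V)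
    (k : nat) (p : 'I_k -> nat) (a : 'I_k -> 'F_2) : Prop :=
  (forall i, (0 < p i)%N) /\
  exists psi : {additive 'rV['F_2]_(\sum_i p i) -> V},
    bijective psi /\
    forall x, phi (psi x) =
              psi (x *m \mxdiag_(i < k) jordan_block (a i) (p i)).

(* The number of Jordan blocks of size r in a Jordan form of phi over F_2
   (0 if there is none). *)
Definition jordan_blocks (V : zmodType) (phi : V -> V) (r : nat) : nat :=
  xget 0%N [set m : nat | exists k (p : 'I_k -> nat) (a : 'I_k -> 'F_2),
    has_jordan_form phi p a /\ m = #|[set i | p i == r]%SET| ].

Definition free_abelian_of_rank (L : zmodType) (r : nat) : Prop :=
  exists b : {additive 'rV[int]_r -> L}, bijective b.

Section DModule.
Variables (gT : finGroupType) (D : {group gT}) (M : zmodType).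
Variable to : action D M.

Definition acts_by_automorphisms : Prop :=
  forall g, g \in D -> {morph to^~ g : v w / v + w}.

Definition fixed_plus (s : gT) : set M := [set v | to v s = v].
Definition fixed_minus (s : gT) : set M := [set v | to v s = - v].

Definition Tel (s : gT) : set M := sumset (fixed_plus s) (fixed_minus s).

Definition image_sub1 (g : gT) : set M := range (fun v => to v g - v).

(* (M(g - 1) + 2 Tel(t)) / 2 Tel(t) *)
Definition Bgroup (t g : gT) : set (quotient_by (twice (Tel t))) :=
  quotient_proj (twice (Tel t)) @` sumset (image_sub1 g) (twice (Tel t)).

Definition act_quotient_Tel (t u : gT) :
    quotient_by (Tel t) -> quotient_by (Tel t) :=
  quotient_map (Tel t) (fun v => to v u).

Definition commutator_subgroup : set M :=
  spanned [set w | exists v g, g \in D /\ w = to v g - v].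

Definition commutator_density (f : gT) : Prop :=
  commutator_subgroup = image_sub1 f.

Definition two_four_generation : Prop :=
  exists a b : gT, [/\ #[a]%g = 2%N, #[b]%g = 2%N,
    <<[set a; b]%SET>>%g = D :> {set gT} &
    [set: M] = sumset (fixed_plus a) (fixed_plus b)].

End DModule.

Arguments Bgroup {gT D M} to t g.
Arguments act_quotient_Tel {gT D M} to t u.

(* Main.v *)
Require Import Defs.
From HB Require Import structures.
From mathcomp Require Import all_boot all_order all_algebra all_fingroup all_solvable.
From mathcomp Require Import all_classical.
From mathcomp Require Import zify.

Set Implicit Arguments.
Unset Strict Implicit.
Unset Printing Implicit Defensive.

Import GRing.Theory.
Local Open Scope ring_scope.
Local Open Scope classical_set_scope.

(** With operators on the right, write T and U for the actions of t and u, and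
    F = TU. The commutator acts as F^2 = -1, so the involutions T and U
    anticommute; and since D is dihedral of order 8, f is tu or its inverse,
    so that L(f-1) = L(tu-1).

    The index comes from two congruences modulo 2. As (F-1)(F+1) = -2 and L has
    no 2-torsion, w lies in L(f-1) iff w + wF lies in 2L
    ([image_sub1_tuP]); likewise w lies in Tel(t) iff w + wT lies in 2L
    ([TelP]). Modulo 2 the operators T and U commute, so that
    (T-1)(F+1) = (U-1)(T+1) mod 2, and therefore

      v(t-1) lies in L(f-1)  iff  v(u-1) lies in Tel(t)

    ([image_sub1_t_tuP]). Modulo L(f-1) we have t = u, so v |-> v(t-1)
    already represents every coset of L(f-1) in L(t-1) + L(u-1). Hence these
    cosets correspond bijectively to the elements of (L/Tel(t))(u-1)
    ([index_Bgroup]). An involution of an F_2-space is unipotent with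
    Jordan blocks of size at most 2, and its difference with 1 has rank the
    number d of blocks of size 2 ([card_range_jordan_blocks]), so the
    index is 2^d.

    As [L,D] = L(a-1) + L(b-1) for every generating pair a, b of D, commutator
    density says that L(t-1) + L(u-1) lies in L(f-1). If fixed points of
    generating involutions a, b span L, a vector v = x + y with xa = x, yb = y
    has v(a-1) = y(ba-1), and ba is f or its inverse. Conversely, density lets
    one write v(t-1) = w(ut-1); then w(u-1) = (v - wu)(t-1) is
    negated by both t and u, so it vanishes because T and U anticommute, and
    v = (v - w) + w splits v into a fixed vector of t and one of u. *)

(** * Cardinals of ranges *)

Lemma bijective_of_inj_surj (A B : Type) (g : A -> B) :
  injective g -> (forall y, exists x, g x = y) -> bijective g.
Proof.
move=> gI gS; have [h hK] := choice gS.
by exists h => // x; apply: gI.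
Qed.

(** Compares an index with the size of an image: cosets and images of one and
    the same map on L have the same fibres. *)
Lemma card_eq_range (A B C : Type) (g : A -> B) (h : A -> C) :
  (forall x y, g x = g y <-> h x = h y) -> (range g #= range h)%card.
Proof.
move=> gh; have [[x0 _]|A0] := pselect (exists x : A, True); last first.
  suff E (X : Type) (k : A -> X) : range k = set0 by rewrite !E card_eq00.
  by apply/seteqP; split=> // y [x]; case: A0; exists x.
have [s sP] : {s : B -> A & forall y, range g y -> g (s y) = y}.
  apply: (@choice B A (fun y x => range g y -> g x = y)) => y.
  have [[x _ gxy]|gNy] := pselect (range g y); first by exists x.
  by exists x0.
have sK x : g (s (g x)) = g x by apply: sP; exists x.
have -> : range h = (h \o s) @` range g.
  apply/seteqP; split=> [_ [x _ <-]|_ [_ [x _ <-] <-]]; last by exists (s (g x)).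
  by exists (g x); [exists x | apply/gh/sK].
apply: card_esym; apply: inj_card_eq => _ _ /set_mem[x _ <-] /set_mem[y _ <-].
by move=> /= hxy; rewrite -[g x]sK -[g y]sK; apply/gh.
Qed.

Lemma card_setT_finType (T : finType) : ([set: T] #= `I_#|T|)%card.
Proof.
have -> : [set: T] = range id by apply/seteqP; split=> // x _; exists x.
apply: card_eq_trans (card_eq_range (h := @enum_rank T) _) _.
  by move=> x y; split=> [->|/enum_rank_inj].
have -> : range (@enum_rank T) = [set: 'I_#|T|].
  by apply/seteqP; split=> // i _; exists (enum_val i) => //; rewrite enum_valK.
by rewrite card_eq_sym card_II.
Qed.

(** * Coordinates on elementary abelian 2-groups *)

Lemma additive_exists (A B : zmodType) (g : A -> B) :
  {morph g : x y / x - y} -> exists h : {additive A -> B}, h =1 g.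
Proof.
move=> gB.
pose m := GRing.isZmodMorphism.Build A B g gB.
pose h : {additive A -> B} := HB.pack g m.
by exists h.
Qed.

Lemma additiveZ_F2 (V : zmodType) m (g : {additive 'rV['F_2]_m -> V}) a w :
  g (a *: w) = g w *+ (a : nat).
Proof. by rewrite -[a in LHS]natr_Zp scaler_nat raddfMn. Qed.

(** Scalar multiplication by F_2, for a vector killed by 2 in a group that
    carries no vector space structure. *)
Lemma F2_scale_exists (V : zmodType) (v : V) : v *+ 2 = 0 ->
  exists h : {additive 'F_2 -> V}, h =1 (fun c => v *+ (c : nat)).
Proof.
move=> v2; apply: additive_exists.
have F2P (c : 'F_2) : c = 0 \/ c = 1.
  by case: c => [[|[|c]] lt_c2] //; [left|right]; apply: val_inj.
have vv : v + v = 0 by rewrite -mulr2n.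
have vN : - v = v by apply/eqP; rewrite eq_sym -subr_eq0 opprK vv.
by move=> x y; case: (F2P x) => ->; case: (F2P y) => -> //=;
  rewrite ?subrr ?subr0 ?sub0r ?mulr1n ?vN.
Qed.

(** A finitely generated group killed by 2 is a quotient of the F_2-space on its
    generators, and a complement of the kernel is mapped bijectively onto it. *)
Lemma elementary_abelian_coordinates (V : zmodType) N
    (b : {additive 'rV[int]_N -> V}) :
    (forall v, exists z, b z = v) -> (forall v : V, v *+ 2 = 0) ->
  exists m (psi : {additive 'rV['F_2]_m -> V}), bijective psi.
Proof.
move=> bS V2.
have [s sE] := choice (fun v => F2_scale_exists (V2 v)).
have [g gE] : exists g : {additive 'rV['F_2]_N -> V},
    g =1 (fun x => \sum_j s (b 'e_j) (x 0 j)).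
  apply: additive_exists => x y; rewrite -sumrB.
  by apply: eq_bigr => j _; rewrite !mxE raddfB.
have gS v : exists x, g x = v.
  have [z <-] := bS v; exists (map_mx intr z).
  rewrite gE [in RHS](row_sum_delta z) raddf_sum; apply: eq_bigr => j _ /=.
  rewrite mxE raddfMz sE mulr1n.
  by rewrite -[X in X *: _]intz scaler_int raddfMz.
pose K := (\sum_(w | g w == 0%R) <<w>>)%MS.
have KP (w : 'rV_N) : (w <= K)%MS -> g w = 0.
  move=> /sub_sumsmxP[c ->]; rewrite raddf_sum big1 // => x /eqP gx0.
  have /submxP[a ->] : (c x *m <<x>>%MS <= x)%MS by rewrite -(genmxE x) submxMl.
  by rewrite (mx11_scalar a) mul_scalar_mx additiveZ_F2 gx0 mul0rn.
pose R := row_base (K^C)%MS.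
have [psi psiE] : exists psi : {additive 'rV['F_2]_(\rank (K^C)%MS) -> V},
    psi =1 (fun c => g (c *m R)).
  by apply: additive_exists => x y; rewrite mulmxBl raddfB.
exists _, psi; apply: bijective_of_inj_surj => [|v].
  apply: raddf_inj => c /eqP; rewrite psiE => gc0.
  apply/eqP; rewrite -(mulmx_free_eq0 _ (row_base_free (K^C)%MS)) -submx0.
  rewrite -(capmx_compl K) sub_capmx; apply/andP; split.
    by rewrite (sumsmx_sup (c *m R)) ?genmxE.
  by rewrite (submx_trans (submxMl _ _)) // eq_row_base.
have [w <-] := gS v.
have /sub_addsmxP[[x y] /= ->] : (w <= K + K^C)%MS.
  by rewrite submx_full // addsmx_compl_full.
have /submxP[c cE] : (y *m K^C <= R)%MS by rewrite eq_row_base submxMl.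
by exists c; rewrite psiE -cE raddfD /= (KP (x *m K)) ?submxMl // add0r.
Qed.

Lemma involution_matrix (V : zmodType) m (psi : {additive 'rV['F_2]_m -> V})
    (phi : {additive V -> V}) : bijective psi ->
  exists A : 'M['F_2]_m, forall x, phi (psi x) = psi (x *m A).
Proof.
case=> psi' psiK psi'K.
exists (\matrix_i psi' (phi (psi 'e_i))) => x.
rewrite {1}[x]row_sum_delta mulmx_sum_row !raddf_sum; apply: eq_bigr => i _ /=.
by rewrite !additiveZ_F2 rowK psi'K raddfMn.
Qed.

(** * Jordan forms of involutions over F_2 *)

(** The rows x, xN, xN^2, ... on which N acts as a nilpotent Jordan block. *)
Definition jordan_chain (F : fieldType) m (N : 'M[F]_m) (x : 'rV[F]_m) q :
  'M[F]_(q, m) := \matrix_(a < q) iter a (mulmx^~ N) x.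

Lemma jordan_block_chain (F : fieldType) m (N : 'M[F]_m) x q :
    iter q (mulmx^~ N) x = 0 ->
  jordan_block 0 q *m jordan_chain N x q = jordan_chain N x q *m N.
Proof.
move=> xN0; apply/row_matrixP => a; rewrite !row_mul mulmx_sum_row.
rewrite [in RHS]rowK -[RHS]/(iter a.+1 (mulmx^~ N) x).
have rowE b : row a (jordan_block 0 q) 0 b = (a.+1 == b :> nat)%:R :> F.
  by rewrite !mxE mul0rn add0r.
under eq_bigr => b _ do rewrite rowE rowK.
have [ltaq|] := ltnP a.+1 q; last first.
  rewrite leq_eqVlt ltnNge ltn_ord orbF => /eqP<-; rewrite xN0 big1 // => b _.
  by rewrite gtn_eqF // scale0r.
rewrite (bigD1 (Ordinal ltaq)) //= eqxx scale1r big1 ?addr0 // => b nab.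
case: eqP => [ab|]; last by rewrite scale0r.
by case/eqP: nab; apply: val_inj.
Qed.

Lemma jordan_blockE (F : fieldType) (a : F) q :
  jordan_block a q = a%:M + jordan_block 0 q.
Proof. by apply/matrixP => i j; rewrite !mxE mul0rn add0r. Qed.

(** The image of N lies in its kernel. Lift a basis xN of the image to vectors x,
    and complete that basis by vectors y to one of the kernel: the chains
    (x, xN) and (y) together form a basis of the whole space. *)
Lemma square_zero_jordan_form (F : fieldType) m (N : 'M[F]_m) : N *m N = 0 ->
  exists k (p : 'I_k -> nat) (P : 'M[F]_(\sum_i p i, m)),
    [/\ forall i, (0 < p i)%N, row_free P, row_full P &
        \mxdiag_(i < k) jordan_block 0 (p i) *m P = P *m N].
Proof.
move=> NN0; set r := \rank N.
pose R := row_base N; pose Y := row_base (kermx N :\: R)%MS.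
have /submxP[X RE] : (R <= N)%MS by rewrite eq_row_base.
set s := \rank (kermx N :\: R)%MS in Y *.
pose p (i : 'I_(r + s)) := if (i < r)%N then 2%N else 1%N.
pose x i := row i (col_mx X Y).
have xl i : x (lshift s i) = row i X by rewrite /x rowKu.
have xr i : x (rshift r i) = row i Y by rewrite /x rowKd.
have YN0 : Y *m N = 0.
  by apply/sub_kermxP; rewrite eq_row_base diffmxSl.
pose P := \mxcol_i jordan_chain N (x i) (p i).
exists (r + s)%N, p, P.
have p_gt0 i : (0 < p i)%N by rewrite /p; case: ifP.
have sRK : (R <= kermx N)%MS by apply/sub_kermxP; rewrite RE -mulmxA NN0 mulmx0.
have PE i a : (a < p i)%N -> (iter a (mulmx^~ N) (x i) <= P)%MS.
  move=> lt_a; rewrite eqmx_col (sumsmx_sup i) // genmxE.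
  by rewrite (eq_row_sub (Ordinal lt_a)) // rowK.
have XP : (X <= P)%MS.
  by apply/row_subP => i; rewrite -xl; apply: (PE _ 0%N).
have YP : (Y <= P)%MS.
  by apply/row_subP => i; rewrite -xr; apply: (PE _ 0%N).
have RP : (R <= P)%MS.
  apply/row_subP => i; rewrite RE row_mul -xl; apply: (PE _ 1%N).
  by rewrite /p /= ltn_ord.
have P_full : row_full P.
  rewrite -sub1mx.
  (* vN is a combination of the xN; subtracting the same combination of the x
     from v leaves a vector of the kernel. *)
  have /submxP[c Nc] : (N <= R)%MS by rewrite eq_row_base.
  rewrite -(subrK (c *m X) 1%:M) addmx_sub //; last first.
    by rewrite (submx_trans (submxMl _ _)).
  have : (1%:M - c *m X <= kermx N)%MS.
    by apply/sub_kermxP; rewrite mulmxBl mul1mx -mulmxA -RE -Nc subrr.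
  move/submx_trans; apply; rewrite -(addsmx_diff_cap_eq (kermx N) R).
  rewrite addsmx_sub (submx_trans (capmxSr _ _) RP) andbT.
  by apply: submx_trans YP; rewrite eq_row_base.
have p_sum : (\sum_i p i = m)%N.
  rewrite big_split_ord /=.
  under eq_bigr do rewrite /p /= ltn_ord.
  under [X in (_ + X)%N]eq_bigr do rewrite /p /= ltnNge leq_addr /=.
  rewrite !sum_nat_const !card_ord muln1 muln2 -addnn -addnA.
  have rkR : \rank (kermx N :&: R)%MS = r by rewrite (capmx_idPr sRK) eq_row_base.
  by rewrite -{2}rkR mxrank_cap_compl mxrank_ker subnKC ?rank_leq_row.
split=> //; first by rewrite /row_free (eqP P_full) p_sum.
rewrite mul_mxdiag_mxcol mxcol_mul; apply/eq_mxcol => i.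
apply: jordan_block_chain; case: (split_ordP i) => j ->.
  by rewrite /p /= ltn_ord /= xl -mulmxA NN0 mulmx0.
by rewrite /p /= ltnNge leq_addr /= xr -row_mul YN0 row0.
Qed.

(** In characteristic 2, (A - 1)^2 = A^2 - 1 = 0 for an involution A. *)
Lemma involution_jordan_form (V : zmodType) m
    (psi : {additive 'rV['F_2]_m -> V}) (phi : {additive V -> V}) :
    bijective psi -> (forall x, phi (phi x) = x) ->
  exists k (p : 'I_k -> nat) (a : 'I_k -> 'F_2), has_jordan_form phi p a.
Proof.
move=> psi_bij phiK; have [A phiE] := involution_matrix phi psi_bij.
have AA : A *m A = 1%:M.
  apply/row_matrixP => i; rewrite !rowE; apply: (bij_inj psi_bij).
  by rewrite mulmxA -!phiE phiK mulmx1.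
have two0 : 2%:R = 0 :> 'F_2 by apply: val_inj.
have NN0 : (A - 1%:M) *m (A - 1%:M) = 0.
  rewrite mulmxBl mul1mx mulmxBr mulmx1 AA -(opprB A) -opprD -mulr2n.
  by rewrite -scaler_nat two0 scale0r oppr0.
have [k [p [P [p_gt0 /row_freeP[P' PP'] /row_fullP[P'' P''P] NP]]]] :=
  square_zero_jordan_form NN0.
have [psiP psiPE] : exists h : {additive 'rV['F_2]_(\sum_i p i) -> V},
    h =1 (fun x => psi (x *m P)).
  by apply: additive_exists => x y; rewrite mulmxBl raddfB.
exists k, p, (fun=> 1); split=> //; exists psiP; split=> [|x].
  apply: bijective_of_inj_surj => [x y|v].
    rewrite !psiPE => /(bij_inj psi_bij) xy.
    by rewrite -[x]mulmx1 -[y]mulmx1 -PP' !mulmxA xy.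
  have [psi' _ psi'K] := psi_bij; exists (psi' v *m P'').
  by rewrite psiPE -mulmxA P''P mulmx1 psi'K.
rewrite !psiPE phiE -!mulmxA; congr (psi (x *m _)).
under eq_mxdiag => i do rewrite jordan_blockE.
by rewrite mxdiagD mxdiagZ mulmxDl mul1mx NP mulmxBr mulmx1 addrC subrK.
Qed.

(** The entry of J^2 two places right of the diagonal is 1, which rules out
    involutory blocks of size above 2; a block of size 2 contributes 1 to the
    rank of J - 1 and a block of size 1 nothing. *)
Lemma jordan_block_involution (a : 'F_2) q : (0 < q)%N ->
    jordan_block a q *m jordan_block a q = 1%:M ->
  a = 1 /\ \rank (jordan_block (0 : 'F_2) q) = (q == 2%N).
Proof.
case: q => // q _ JJ.
have a1 : a = 1.
  move/matrixP/(_ ord_max ord_max): JJ; rewrite !mxE (bigD1 ord_max) //=.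
  rewrite !mxE eqxx !mulr1n gtn_eqF // addr0 big1 ?addr0 => [|j nj].
    by case: a => [[|[|c]] lt_c2] // _; apply: val_inj.
  rewrite !mxE eq_sym (negPf nj) mulr0n add0r gtn_eqF ?mul0r // ltn_ord.
split=> //; case: q => [|[|q]] in JJ *.
- apply/eqP; rewrite /= mxrank_eq0; apply/eqP/matrixP => i j.
  by rewrite !mxE !ord1 mul0rn addr0.
- rewrite (_ : jordan_block _ _ = delta_mx 0 1) ?mxrank_delta //.
  apply/matrixP => i j; rewrite !mxE mul0rn add0r.
  by case: i j => [[|[|i]] i2] [[|[|j]] j2].
move/matrixP/(_ ord0 (lift ord0 (lift ord0 ord0))): JJ.
rewrite !mxE 3!big_ord_recl big1 => [|j _]; rewrite !mxE /=.
  by rewrite a1 => /eqP.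
by rewrite mulr0n add0r mul0r.
Qed.

Lemma card_range_mulmx (F : finFieldType) m n (A : 'M[F]_(m, n)) :
  (range (fun x : 'rV[F]_m => x *m A) #= `I_(#|F| ^ \rank A))%card.
Proof.
have -> : range (fun x : 'rV[F]_m => x *m A) =
          range (fun c : 'rV[F]_(\rank A) => c *m row_base A).
  apply/seteqP; split=> _ [x _ <-].
    have /submxP[c ->] : (x *m A <= row_base A)%MS by rewrite eq_row_base submxMl.
    by exists c.
  have /submxP[c ->] : (x *m row_base A <= A)%MS.
    by rewrite (submx_trans (submxMl _ _)) // eq_row_base.
  by exists c.
apply: card_eq_trans (card_eq_range (h := id) _) _.
  by move=> x y; split=> [/(row_free_inj (row_base_free A))|->].
have -> : range id = [set: 'rV[F]_(\rank A)] by apply/seteqP; split=> // x; exists x.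
by have := card_setT_finType 'rV[F]_(\rank A); rewrite card_mx mul1n.
Qed.

(** Shows that the number of blocks of size 2 does not depend on the Jordan form:
    it is the dimension of the image of phi - 1. *)
Lemma card_range_jordan_form (V : zmodType) (phi : {additive V -> V})
    k (p : 'I_k -> nat) (a : 'I_k -> 'F_2) :
    (forall x, phi (phi x) = x) -> has_jordan_form phi p a ->
  (range (fun x => (phi x - x)%R) #= `I_(2 ^ #|[set i | p i == 2%N]%SET|))%card.
Proof.
move=> phiK [p_gt0 [psi [psi_bij phiE]]].
set J := \mxdiag_(i < k) _ in phiE.
have JJ : J *m J = 1%:M.
  apply/row_matrixP => i; rewrite !rowE; apply: (bij_inj psi_bij).
  by rewrite mulmxA -!phiE phiK mulmx1.
have JiJi i : jordan_block (a i) (p i) *m jordan_block (a i) (p i) = 1%:M.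
  move: JJ; rewrite -mxdiagZ mul_mxdiag_mxblock.
  move=> /(congr1 (fun M => submxblock M i i)).
  by rewrite submxblock_diag mxblockK eqxx conform_mx_id.
have JE : J - 1%:M = \mxdiag_(i < k) jordan_block 0 (p i).
  rewrite -mxdiagZ -mxdiagB; apply/eq_mxdiag => i.
  have [ai1 _] := jordan_block_involution (p_gt0 i) (JiJi i).
  by rewrite jordan_blockE ai1 addrC addKr.
have rkJ : \rank (J - 1%:M) = #|[set i | p i == 2%N]%SET|.
  rewrite JE rank_mxdiag -sum1dep_card [RHS]big_mkcond; apply: eq_bigr => i _ /=.
  by have [_ ->] := jordan_block_involution (p_gt0 i) (JiJi i); case: eqP.
have -> : range (fun x => phi x - x) = range (fun x => psi (x *m (J - 1%:M))).
  have [psi' _ psi'K] := psi_bij.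
  apply/seteqP; split=> _ [x _ <-].
    by exists (psi' x) => //; rewrite mulmxBr mulmx1 raddfB -phiE psi'K.
  by exists (psi x) => //; rewrite mulmxBr mulmx1 raddfB -phiE.
apply: card_eq_trans (card_eq_range (h := fun x => x *m (J - 1%:M)) _) _.
  by move=> x y; split=> [/(bij_inj psi_bij)|->].
by have := card_range_mulmx (J - 1%:M); rewrite rkJ card_Fp.
Qed.

(** Since the block count defaults to 0 for a map without a Jordan form, both
    existence and independence of the form are needed here. *)
Lemma card_range_jordan_blocks (V : zmodType) N
    (b : {additive 'rV[int]_N -> V}) (phi : {additive V -> V}) :
    (forall v, exists z, b z = v) -> (forall v : V, v *+ 2 = 0) ->
    (forall x, phi (phi x) = x) ->
  (range (fun x => (phi x - x)%R) #= `I_(2 ^ jordan_blocks phi 2))%card.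
Proof.
move=> bS V2 phiK; rewrite /jordan_blocks.
case: xgetP => [_ -> [k [p [a [form ->]]]]|noform].
  exact: card_range_jordan_form form.
have [m [psi psi_bij]] := elementary_abelian_coordinates bS V2.
have [k [p [a form]]] := involution_jordan_form psi_bij phiK.
by case: (noform #|[set i | p i == 2%N]%SET|); exists k, p, a.
Qed.

(** * Subgroups and quotients *)

Section Quotients.
Variable V : zmodType.
Implicit Types A H K : set V.

Lemma subgroupD H x y : additive_subgroup H -> H x -> H y -> H (x + y).
Proof.
case=> H0 HB Hx Hy; rewrite -[y]opprK; apply: (HB) => //.
by rewrite -[- y]sub0r; apply: HB.
Qed.

Lemma subgroup_twice H : additive_subgroup H -> additive_subgroup (twice H).
Proof.
case=> H0 HB; split; first by exists 0; rewrite ?mul0rn.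
by move=> _ _ [x Hx <-] [y Hy <-]; exists (x - y); [exact: HB|rewrite mulrnBl].
Qed.

Lemma subgroup_sumset H K :
  additive_subgroup H -> additive_subgroup K -> additive_subgroup (sumset H K).
Proof.
move=> [H0 HB] [K0 KB]; split; first by exists 0 => //; exists 0; rewrite ?addr0.
move=> _ _ [x Hx [y Ky <-]] [x' Hx' [y' Ky' <-]].
by exists (x - x'); [exact: HB | exists (y - y'); [exact: KB|rewrite opprD addrACA]].
Qed.

Lemma quotient_projB A x y :
  quotient_proj A (x - y) = quotient_proj A x - quotient_proj A y.
Proof. by rewrite /quotient_proj !piE. Qed.

Lemma quotient_projD A x y :
  quotient_proj A (x + y) = quotient_proj A x + quotient_proj A y.
Proof. by rewrite /quotient_proj !piE. Qed.

Lemma quotient_proj_surj A (q : quotient_by A) : exists x, quotient_proj A x = q.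
Proof. by exists (generic_quotient.repr q); exact: generic_quotient.reprK. Qed.

Lemma quotient_proj_eq A x y : additive_subgroup A ->
  quotient_proj A x = quotient_proj A y <-> A (x - y).
Proof.
move=> sA; rewrite -[A in A (x - y)](spanned_id sA); split=> [/eqP|Axy].
  by rewrite -Quotient.idealrBE => /asboolP.
by apply/eqP; rewrite -Quotient.idealrBE; apply/asboolP.
Qed.

Lemma quotient_map_proj A (phi : V -> V) x : additive_subgroup A ->
    {morph phi : x y / x - y} -> (forall y, A y -> A (phi y)) ->
  quotient_map A phi (quotient_proj A x) = quotient_proj A (phi x).
Proof.
move=> sA phiB phiA; apply/quotient_proj_eq => //; rewrite -phiB; apply: phiA.
by apply/(quotient_proj_eq _ _ sA); exact: generic_quotient.reprK.
Qed.

Lemma coset_eq H x y : additive_subgroup H ->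
  [set x + h | h in H] = [set y + h | h in H] <-> H (x - y).
Proof.
move=> sH; split=> [xy|Hxy].
  have : [set y + h | h in H] x by rewrite -xy; exists 0; [case: sH|rewrite addr0].
  by case=> h Hh <-; rewrite addrC addKr.
have Hyx : H (y - x) by rewrite -opprB -sub0r; case: sH => H0; apply.
apply/seteqP; split=> _ [h Hh <-].
  by exists (x - y + h); [exact: subgroupD|rewrite addrA [y + _]addrC subrK].
by exists (y - x + h); [exact: subgroupD|rewrite addrA [x + _]addrC subrK].
Qed.

Lemma subgroup_image_proj A H : additive_subgroup H ->
  additive_subgroup (quotient_proj A @` H).
Proof.
case=> H0 HB; split; first by exists 0 => //; rewrite -[0]subr0 quotient_projB subrr.
move=> _ _ [x Hx <-] [y Hy <-]; exists (x - y); first exact: HB.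
exact: quotient_projB.
Qed.

End Quotients.

(** * Elements of order 4 in the dihedral group of order 8 *)

Lemma generators_mem (gT : finGroupType) (D : {group gT}) (a b : gT) :
  D = <<[set a; b]%SET>>%g :> {set gT} -> a \in D /\ b \in D.
Proof.
move=> DE; split; rewrite -[_ \in D]/(_ \in (D : {set gT})) DE mem_gen //.
  exact: set21.
exact: set22.
Qed.

(** Elements outside the rotation group <ab> are involutions, so f is a power of
    ab. The order of ab divides 8 and is a multiple of 4; it is not 8, as
    otherwise <ab> would be all of D, and then a would commute with ab although
    it inverts ab. *)
Lemma dihedral8_order4 (gT : finGroupType) (D : {group gT}) (a b f : gT) :
    #[a]%g = 2%N -> #[b]%g = 2%N -> D = <<[set a; b]%SET>>%g :> {set gT} ->
    (D \isog 'D_8)%g -> f \in D -> #[f]%g = 4%N ->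
  f = (a * b)%g \/ f = (a * b)^-1%g.
Proof.
move=> oa ob DE isoD fD of4.
have [aV bV] := (invg2id oa, invg2id ob).
set x := (a * b)%g.
have xa : (x ^ a = x^-1)%g by rewrite /x conjgE -mulgA mulKg invMg aV bV.
have [aD bD] := generators_mem DE.
have aN : <[a]>%g \subset 'N(<[x]>)%g.
  by rewrite cycle_subG; apply/normP; rewrite -cycleJ xa cycleV.
have fxa : f \in (<[x]> * <[a]>)%g.
  rewrite -norm_joinEr //; apply: (fintype.subsetP _ _ fD); rewrite DE gen_subG.
  have xJ : x \in (<[x]> <*> <[a]>)%g by rewrite mem_gen // inE cycle_id.
  have aJ : a \in (<[x]> <*> <[a]>)%g by rewrite mem_gen // inE cycle_id orbT.
  apply/fintype.subsetP => y /set2P[->|->] //.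
  by rewrite -[b](mulKg a) groupM ?groupV.
have fx : f \in <[x]>%g.
  case/mulsgP: fxa => y z xy; rewrite cycle2g // => /set2P[]-> fE.
    by rewrite fE mulg1.
  have yV : (y ^ a = y^-1)%g by case/cycleP: xy => i ->; rewrite conjXg xa expgVn.
  have ya2 : ((y * a) ^+ 2 = 1)%g.
    by rewrite expgS expg1 -{1}aV -[(y * a^-1 * (y * a))%g]mulgA -conjgE yV mulgV.
  by move: (order_dvdn (y * a)%g 2); rewrite -fE of4 fE ya2 eqxx.
have x_gt : (4 %| #[x]%g)%N by rewrite -of4 order_dvdG.
have oD : #|D| = 8%N by rewrite (card_isog isoD) (@card_dihedral 4).
have xD : (<[x]> \subset D)%g by rewrite cycle_subG groupM.
have ox_dvd : (#[x]%g %| 8)%N by rewrite -oD cardSg.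
have ox8 : #[x]%g != 8%N.
  apply/eqP => ox; have xDE : <[x]>%g = D by apply/eqP; rewrite eqEcard xD oD -ox /=.
  have ax : (x ^ a = x)%g.
    apply/conjg_fixP/commgP; apply: (centsP (cycle_abelian x)); first exact: cycle_id.
    by rewrite xDE.
  have : (#[x]%g %| 2)%N.
    by rewrite order_dvdn expgS expg1 -{1}ax xa mulVg.
  by rewrite ox.
have ox : #[x]%g = 4%N.
  move: ox_dvd ox8; case/dvdnP: x_gt => [[|[|[|m]]]] -> // /dvdn_leq; lia.
case/cyclePmin: fx => i; rewrite ox => i4 fE.
case: i => [|[|[|[|i]]]] in i4 fE *.
- by move: of4; rewrite fE expg0 order1.
- by left; rewrite fE expg1.
- have : (#[f]%g %| 2)%N by rewrite order_dvdn fE -expgM -(order_dvdn x 4) ox.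
  by rewrite of4.
- right; rewrite fE; apply/eqP; rewrite eq_sym eq_invg_mul -expgS.
  by rewrite -(order_dvdn x 4) ox.
- by [].
Qed.

(** * Actions by automorphisms *)

Section ActionByAutomorphisms.
Variables (gT : finGroupType) (D : {group gT}) (L : zmodType).
Variable to : action D L.

Lemma action_axiom : is_action D to. Proof. by case: to. Qed.

Hypothesis toD : acts_by_automorphisms to.
Implicit Types (g h : gT) (v w : L).

Lemma actB g v w : g \in D -> to (v - w) g = to v g - to w g.
Proof. by move=> gD; apply/eqP; rewrite eq_sym subr_eq -toD // subrK. Qed.

Lemma act0 g : g \in D -> to 0 g = 0.
Proof. by move=> gD; rewrite -[X in to X](subrr 0) actB // subrr. Qed.

Lemma actN g v : g \in D -> to (- v) g = - to v g.
Proof. by move=> gD; rewrite -[- v]sub0r actB // act0 // sub0r. Qed.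

Lemma act_mul g h v : g \in D -> h \in D -> to v (g * h)%g = to (to v g) h.
Proof. by have [_ aM] := action_axiom; apply: aM. Qed.

Lemma act_one v : to v 1%g = v.
Proof.
by have [aI aM] := action_axiom; apply: (aI 1%g); rewrite -aM ?group1 // mulg1.
Qed.

Lemma subgroup_image_sub1 g : g \in D -> additive_subgroup (image_sub1 to g).
Proof.
move=> gD; split; first by exists 0; rewrite // subr0 act0.
move=> _ _ [v _ <-] [w _ <-]; exists (v - w) => //.
by rewrite actB // !opprB addrACA [RHS]addrACA [- to w g - v]addrC.
Qed.

Lemma image_sub1V g : g \in D -> image_sub1 to g^-1%g = image_sub1 to g.
Proof.
have sub h : h \in D -> image_sub1 to h^-1%g `<=` image_sub1 to h.
  move=> hD _ [v _ <-]; exists (- to v h^-1%g) => //.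
  by rewrite actN // -act_mul ?groupV // mulVg act_one opprK addrC.
by move=> gD; apply/seteqP; split; [exact: sub|rewrite -{1}[g]invgK; apply: sub; rewrite groupV].
Qed.

Lemma image_sub1M g h : g \in D -> h \in D ->
  image_sub1 to (g * h)%g `<=` sumset (image_sub1 to g) (image_sub1 to h).
Proof.
move=> gD hD _ [v _ <-]; exists (to v g - v); first by exists v.
exists (to (to v g) h - to v g); first by exists (to v g).
by rewrite act_mul // addrC addrA subrK.
Qed.

(** From v(gh-1) = (vg)(h-1) + v(g-1), the elements g with L(g-1) inside
    L(a-1) + L(b-1) form a subgroup, which contains a and b. *)
Lemma commutator_subgroup_gen a b : D = <<[set a; b]%SET>>%g :> {set gT} ->
  commutator_subgroup to = sumset (image_sub1 to a) (image_sub1 to b).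
Proof.
move=> DE.
have [aD bD] := generators_mem DE.
have Ssub := subgroup_sumset (subgroup_image_sub1 aD) (subgroup_image_sub1 bD).
set S := sumset _ _ in Ssub *.
apply/seteqP; split=> [w|_ [_ [v _ <-] [_ [w _ <-] <-]] H sH cH]; last first.
  by apply: subgroupD => //; apply: cH; [exists v, a|exists w, b].
apply=> // _ [v [g [gD ->]]].
pose G := [set h in D | `[< forall v, S (to v h - v) >]]%SET.
have GP h : reflect (h \in D /\ forall v, S (to v h - v)) (h \in G).
  by rewrite inE; apply: (iffP andP) => -[hD /asboolP].
have G_group : group_set G.
  apply/group_setP; split=> [|h k /GP[hD Sh] /GP[kD Sk]].
    by apply/GP; split=> // x; rewrite act_one subrr; case: Ssub.
  apply/GP; split=> [|x]; first exact: groupM.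
  rewrite act_mul //.
  have -> : to (to x h) k - x = (to (to x h) k - to x h) + (to x h - x).
    by rewrite addrA subrK.
  exact: subgroupD.
suff : g \in Group G_group by case/GP.
apply: (fintype.subsetP _ _ gD); rewrite DE gen_subG.
apply/fintype.subsetP => _ /set2P[->|->]; apply/GP; split=> // x.
  by exists (to x a - x); [exists x|exists 0; [case: (subgroup_image_sub1 bD)|rewrite addr0]].
by exists 0; [case: (subgroup_image_sub1 aD)|exists (to x b - x); [exists x|rewrite add0r]].
Qed.

End ActionByAutomorphisms.

(** * Anticommuting involutions *)

Lemma involution_actK (gT : finGroupType) (D : {group gT}) (L : zmodType)
    (to : action D L) g v : g \in D -> #[g]%g = 2%N -> to (to v g) g = v.
Proof.
move=> gD g2; rewrite -(act_mul to) // -{1}(invg2id g2) mulVg.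
exact: act_one.
Qed.

Section AnticommutingInvolutions.
Variables (gT : finGroupType) (D : {group gT}) (L : zmodType).
Variables (to : action D L) (toD : acts_by_automorphisms to) (t u : gT).
Hypotheses (tD : t \in D) (uD : u \in D).
Hypotheses (t2 : #[t]%g = 2%N) (u2 : #[u]%g = 2%N).
Hypothesis commutator_opp : forall v : L, to v [~ t, u]%g = - v.
Hypothesis torsion_free2 : forall v : L, v *+ 2 = 0 -> v = 0.
Implicit Types v w x y : L.

Local Notation "v ^t" := (to v t) (at level 2, format "v ^t").
Local Notation "v ^u" := (to v u) (at level 2, format "v ^u").

Let ttK v : v^t^t = v. Proof. exact: involution_actK. Qed.
Let uuK v : v^u^u = v. Proof. exact: involution_actK. Qed.

Lemma mul2_inj v w : v *+ 2 = w *+ 2 -> v = w.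
Proof.
move=> vw; apply/eqP; rewrite -subr_eq0; apply/eqP/torsion_free2.
by rewrite mulrnBl vw subrr.
Qed.

Lemma anticommute v : v^u^t = - v^t^u.
Proof.
have : v^u^t^u = - v^t.
  rewrite -commutator_opp commgEl /conjg (invg2id t2) (invg2id u2).
  by rewrite !act_mul ?groupM // ttK.
by move/(congr1 (to^~ u)); rewrite uuK actN.
Qed.

(** The half x of w + wt is fixed by t for lack of 2-torsion, and w - x is
    negated. *)
Lemma TelP w : Tel to t w <-> exists x, w + w^t = x *+ 2.
Proof.
split=> [[x xt [y yt <-]]|[x wx]].
  by exists x; rewrite toD // xt yt addrACA subrr addr0.
have xt : x^t = x.
  by apply: mul2_inj; rewrite mulr2n -toD // -mulr2n -wx toD // ttK addrC.
exists x => //; exists (w - x); last by rewrite addrC subrK.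
rewrite /fixed_minus /= actB // xt opprB; apply: (addrI w).
by rewrite !addrA wx mulr2n addrK addrC addKr.
Qed.

(** F = tu satisfies F^2 = -1, so (F-1)(F+1) = -2. *)
Lemma image_sub1_tuP w :
  image_sub1 to (t * u)%g w <-> exists x, w + w^t^u = x *+ 2.
Proof.
have FF v : v^t^u^t^u = - v by rewrite anticommute ttK actN // uuK.
split=> [[x _ <-]|[x wx]].
  exists (- x); rewrite act_mul // !actB // FF.
  by rewrite addrACA [- x - _]addrC addrACA subrr add0r mulr2n.
exists (- x) => //; rewrite act_mul // !actN // opprK.
have xF : x^t^u *+ 2 = w^t^u - w.
  by rewrite mulr2n -!toD // -mulr2n -wx !toD // FF.
apply: mul2_inj; rewrite mulrnDl mulNrn xF -wx opprB addrACA.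
by rewrite [- w^t^u + _]addrC subrr addr0 mulr2n.
Qed.

Lemma twice_Tel_sub : twice (Tel to t) `<=` image_sub1 to (t * u)%g.
Proof.
move=> _ [x _ <-]; apply/image_sub1_tuP; exists (x + x^t^u).
by rewrite mulrnDl [x^t^u *+ 2]mulr2n -!toD // -mulr2n.
Qed.

(** Both conditions say that v(t+1)(u+1) vanishes modulo 2. *)
Lemma image_sub1_t_tuP v :
  image_sub1 to (t * u)%g (v^t - v) <-> Tel to t (v^u - v).
Proof.
have E : v^t - v + (v^t - v)^t^u = v^u - v + (v^u - v)^t + v^t *+ 2.
  rewrite !actB // ttK anticommute mulr2n.
  rewrite [RHS]addrA [X in _ = X + _ + _]addrA subrK [RHS]addrC addrACA -!addrA.
  by [].
split=> [/image_sub1_tuP[x]|/TelP[x xE]].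
  rewrite E => xE; apply/TelP; exists (x - v^t).
  by rewrite mulrnBl -xE addrK.
by apply/image_sub1_tuP; exists (x + v^t); rewrite E xE mulrnDl.
Qed.

Lemma subgroup_Tel : additive_subgroup (Tel to t).
Proof.
apply: subgroup_sumset; split; rewrite /fixed_plus /fixed_minus /= ?act0 ?oppr0 //.
  by move=> x y xt yt; rewrite actB // xt yt.
by move=> x y xt yt; rewrite actB // xt yt opprD.
Qed.

Lemma Tel_act_u v : Tel to t v -> Tel to t v^u.
Proof.
case/TelP=> x vx; apply/TelP; exists (v - x)^u.
rewrite anticommute mulr2n -toD // -mulr2n mulrnBl -vx.
by rewrite mulr2n opprD addrACA subrr add0r actB.
Qed.

Lemma act_quotient_TelE v :
  act_quotient_Tel to t u (quotient_proj (Tel to t) v) =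
  quotient_proj (Tel to t) v^u.
Proof.
apply: quotient_map_proj => [|x y|]; first exact: subgroup_Tel.
  exact: actB.
exact: Tel_act_u.
Qed.

Lemma double_quotient_Tel (q : quotient_by (Tel to t)) : q *+ 2 = 0.
Proof.
have [v <-] := quotient_proj_surj q; rewrite mulr2n -quotient_projD.
rewrite -(subrr (quotient_proj _ 0)) -quotient_projB subrr.
apply/quotient_proj_eq; first exact: subgroup_Tel.
rewrite subr0; apply/TelP; exists (v + v^t).
by rewrite toD // [in RHS]mulrnDl !mulr2n.
Qed.

Lemma card_range_act_quotient_Tel r (b : {additive 'rV[int]_r -> L}) :
    bijective b ->
  (range (fun v => quotient_proj (Tel to t) (v^u - v)%R)
     #= `I_(2 ^ jordan_blocks (act_quotient_Tel to t u) 2))%card.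
Proof.
move=> [b' _ b'K].
have [pb pbE] : exists h : {additive 'rV[int]_r -> quotient_by (Tel to t)},
    h =1 (fun z => quotient_proj (Tel to t) (b z)).
  by apply: additive_exists => x y; rewrite raddfB quotient_projB.
have [phi /funext phiE] : exists h : {additive quotient_by (Tel to t) ->
    quotient_by (Tel to t)}, h =1 act_quotient_Tel to t u.
  apply: additive_exists => p q.
  have [v <-] := quotient_proj_surj p; have [w <-] := quotient_proj_surj q.
  by rewrite -quotient_projB !act_quotient_TelE actB // quotient_projB.
have phi_range : range (fun v => quotient_proj (Tel to t) (v^u - v)) =
    range (fun q => phi q - q).
  apply/seteqP; split=> _ [v _ <-].
    by exists (quotient_proj (Tel to t) v) => //;
      rewrite phiE act_quotient_TelE quotient_projB.
  have [w <-] := quotient_proj_surj v; exists w => //.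
  by rewrite phiE act_quotient_TelE quotient_projB.
rewrite phi_range -phiE; apply: (card_range_jordan_blocks (b := pb)).
- move=> q; have [v <-] := quotient_proj_surj q; exists (b' v).
  by rewrite pbE b'K.
- exact: double_quotient_Tel.
move=> q; have [v <-] := quotient_proj_surj q.
by rewrite phiE !act_quotient_TelE uuK.
Qed.

Local Notation It := (image_sub1 to t).
Local Notation Iu := (image_sub1 to u).
Local Notation Itu := (image_sub1 to (t * u)%g).
Local Notation proj := (quotient_proj (twice (Tel to t))).

Lemma subgroup_Itu : additive_subgroup Itu.
Proof. by apply: subgroup_image_sub1 => //; apply: groupM. Qed.

Lemma proj_Itu x : (proj @` Itu) (proj x) <-> Itu x.
Proof.
split=> [[y Iy /quotient_proj_eq]|]; last by exists x.
move=> /(_ (subgroup_twice subgroup_Tel)) /twice_Tel_sub Iyx.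
have -> : x = y - (y - x) by rewrite opprB addrC subrK.
by case: subgroup_Itu => _; apply.
Qed.

(** The coset of L(f-1) containing v(t-1) and the class of v(u-1) modulo Tel(t)
    determine each other, by [image_sub1_t_tuP]. *)
Lemma index_Bgroup r (b : {additive 'rV[int]_r -> L}) : bijective b ->
  index_eq (sumset (Bgroup to t t) (Bgroup to t u)) (proj @` Itu)
    (2 ^ jordan_blocks (act_quotient_Tel to t u) 2).
Proof.
move=> b_bij.
have proj0 : proj 0 = 0 by rewrite -(subrr 0) quotient_projB subrr.
have T0 := proj1 (subgroup_twice subgroup_Tel).
have Bproj g x : image_sub1 to g x -> Bgroup to t g (proj x).
  by move=> Ix; exists x => //; exists x => //; exists 0; rewrite ?addr0.
have BprojP g q : Bgroup to t g q -> exists2 x, image_sub1 to g x & q = proj x.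
  case=> _ [x Ix [y Ty <-]] <-; exists x => //.
  apply/quotient_proj_eq; first exact: subgroup_twice subgroup_Tel.
  by rewrite addrC addKr.
split.
  move=> _ [x /(image_sub1M tD uD)[y Iy [z Iz <-]] <-].
  by exists (proj y); [exact: Bproj|exists (proj z); [exact: Bproj|rewrite quotient_projD]].
pose coset x := [set proj x + h | h in proj @` Itu].
have coset_eqE x y : coset x = coset y <-> Itu (x - y).
  rewrite /coset coset_eq; last exact: subgroup_image_proj subgroup_Itu.
  by rewrite -quotient_projB proj_Itu.
have -> : [set [set q + h | h in proj @` Itu] | q in
             sumset (Bgroup to t t) (Bgroup to t u)] =
          range (fun v => coset (v^t - v)).
  apply/seteqP; split=> z [].
    move=> _ [_ /BprojP[_ [v _ <-] ->] [_ /BprojP[_ [w _ <-] ->] <-]] <-.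
    (* As w(u-1) = (wt)(tu-1) - (wt)(t-1), the vector v - wt represents the
       coset of v(t-1) + w(u-1). *)
    exists (v - w^t) => //; rewrite -quotient_projD; apply/coset_eqE.
    exists (- w^t) => //; rewrite act_mul // actN // ttK actN // actB // ttK.
    apply/eqP; rewrite eq_sym subr_eq !opprK [- w^u + _]addrC.
    apply/eqP; rewrite -[RHS]addrA [v^t - v + _]addrC -[w^u - w + _]addrA addKr.
    rewrite opprB [LHS]addrC -[LHS]addrA.
    by congr (_ + _); rewrite addrCA [RHS]addrCA [- v - w]addrC.
  move=> v _ <-; exists (proj (v^t - v)) => //; exists (proj (v^t - v)).
    by apply: Bproj; exists v.
  exists 0; last by rewrite addr0.
  by rewrite -proj0; apply: Bproj; exists 0; rewrite // act0 ?subr0.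
apply: card_eq_trans (card_eq_range _) (card_range_act_quotient_Tel b_bij).
move=> v w; rewrite coset_eqE quotient_proj_eq; last exact: subgroup_Tel.
have E g : g \in D -> to v g - v - (to w g - w) = to (v - w) g - (v - w).
  by move=> gD; rewrite actB // !opprB addrACA [RHS]addrACA [- to w g - _]addrC.
by rewrite !E // image_sub1_t_tuP.
Qed.

(** If d = 0, then (L/Tel(t))(u-1) is trivial, so L(t-1) lies in L(tu-1), and
    with it L(u-1), since w(u-1) = (wt)(tu-1) - (wt)(t-1). *)
Lemma image_sub1_f_eq r (b : {additive 'rV[int]_r -> L}) : bijective b ->
  Itu = sumset It Iu <-> jordan_blocks (act_quotient_Tel to t u) 2 = 0%N.
Proof.
move=> b_bij; have card_d := card_range_act_quotient_Tel b_bij.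
set d := jordan_blocks _ _ in card_d *.
set chi := fun v => _ in card_d.
have chi0 : chi 0 = 0 by rewrite /chi act0 // !subr0 -(subrr 0) quotient_projB subrr.
have chi_eq0 v : chi v = 0 <-> Itu (v^t - v).
  rewrite image_sub1_t_tuP -chi0 quotient_proj_eq; last exact: subgroup_Tel.
  by rewrite act0 // !subr0.
have chi_range : range chi = [set 0] <-> forall v, chi v = 0.
  split=> [E v|E]; first by have : range chi (chi v) by [exists v]; rewrite E.
  by apply/seteqP; split=> [_ [v _ <-]|_ ->]; [exact: E|exists 0].
have -> : d = 0%N <-> range chi = [set 0].
  split=> [d0|E].
    move: card_d; rewrite d0 => /eq_cardSP[q _].
    rewrite II0 card_eq0 => /eqP; rewrite setD_eq0 => sub_q.
    have q0 : q = 0 by rewrite -chi0; apply/esym/sub_q; exists 0.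
    by rewrite q0 in sub_q; apply/seteqP; split=> // _ ->; exists 0.
  move: card_d; rewrite E => /card_esym/card_eq_trans/(_ (card_set1 (x := 0))).
  by move=> /card_eq_II/eqP; rewrite -(expn0 2) eqn_exp2l // => /eqP.
rewrite chi_range; split=> [E v|E].
  apply/chi_eq0; rewrite E; exists (v^t - v); first by exists v.
  by exists 0; rewrite ?addr0 //; exists 0; rewrite // act0 ?subr0.
apply/seteqP; split; first exact: image_sub1M.
have [I0 IB] := subgroup_Itu.
have It_Itu v : Itu (v^t - v) by apply/chi_eq0.
move=> _ [_ [v _ <-] [_ [w _ <-] <-]]; apply: subgroupD => //.
have -> : w^u - w = (to w^t (t * u)%g - w^t) - (w^t^t - w^t).
  by rewrite act_mul // ttK opprB addrA subrK.
by apply: IB => //; exists w^t.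
Qed.

(** Writing v(t-1) = w(ut-1) gives y = w(u-1) = (v - wu)(t-1), which t and u
    both negate; anticommutation then forces y = -y, so w is fixed by u and
    v - w by t. *)
Lemma fixed_points_generate : sumset It Iu `<=` Itu ->
  [set: L] = sumset (fixed_plus to t) (fixed_plus to u).
Proof.
move=> sub; apply/seteqP; split=> // v _.
have : Itu (v^t - v).
  apply: sub; exists (v^t - v); first by exists v.
  by exists 0; rewrite ?addr0 //; exists 0; rewrite // act0 ?subr0.
rewrite -(image_sub1V toD) ?groupM // invMg (invg2id t2) (invg2id u2) => -[w _].
rewrite act_mul // => wv; pose y := w^u - w.
have yt : y^t = - y.
  have -> : y = (v - w^u)^t - (v - w^u).
    rewrite actB // opprB [w^u - v]addrC addrACA -wv addrACA.
    by rewrite subrr add0r addrC.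
  by rewrite actB // ttK opprB.
have yu : y^u = - y by rewrite actB // uuK opprB.
have y0 : y = 0.
  apply: torsion_free2; rewrite mulr2n; apply/eqP; rewrite addr_eq0 -yt.
  have := anticommute y; rewrite yu yt !actN // yt yu opprK => <-.
  by [].
have wu : w^u = w by apply/eqP; rewrite -subr_eq0 -/y y0.
exists (v - w); last by exists w => //; rewrite subrK.
rewrite wu in wv; rewrite /fixed_plus /= actB //; apply/eqP.
by rewrite subr_eq -addrA [- w + _]addrC wv [v + _]addrC subrK.
Qed.

End AnticommutingInvolutions.

(** For x fixed by a and y fixed by b, (x + y)(a-1) = y(ba-1). *)
Lemma image_sub1_fixed_points (gT : finGroupType) (D : {group gT}) (L : zmodType)
    (to : action D L) (a b : gT) :
    acts_by_automorphisms to -> a \in D -> b \in D ->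
    [set: L] = sumset (fixed_plus to a) (fixed_plus to b) ->
  image_sub1 to a `<=` image_sub1 to (b * a)%g.
Proof.
move=> toD aD bD LE _ [v _ <-].
have : [set: L] v by [].
rewrite LE => -[x xa [y yb <-]]; exists y => //.
by rewrite act_mul // yb toD // xa opprD addrACA subrr add0r.
Qed.

(** * The index and the two module properties *)

Theorem lemma2p14 (gT : finGroupType) (D : {group gT}) (t u f : gT)
    (L : zmodType) (to : action D L) (n d e : nat)
    (t_inv : #[t]%g = 2%N) (u_inv : #[u]%g = 2%N)
    (D_gen : D = <<[set t; u]%SET>>%g :> {set gT})
    (D_dihedral : (D \isog 'D_8)%g)
    (f_in_D : f \in D) (f_order : #[f]%g = 4%N)
    (L_free : free_abelian_of_rank L (2 * n))
    (to_additive : acts_by_automorphisms to)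
    (central_opp : forall v : L, to v [~ t, u]%g = - v)
    (d_def : d = jordan_blocks (act_quotient_Tel to t u) 2)
    (e_def : e = jordan_blocks (act_quotient_Tel to t u) 1) :
  [/\ index_eq (sumset (Bgroup to t t) (Bgroup to t u))
               (quotient_proj (twice (Tel to t)) @` image_sub1 to f)
               (2 ^ ((n + 3 * d + e) - (2 * d + e + n)))%N,
      (2 ^ ((n + 3 * d + e) - (2 * d + e + n)) = 2 ^ d)%N,
      image_sub1 to f = sumset (image_sub1 to t) (image_sub1 to u) <-> d = 0%N
    & commutator_density to f <-> two_four_generation to].
Proof.
have [tD uD] := generators_mem D_gen.
have image_fE a b : #[a]%g = 2%N -> #[b]%g = 2%N ->
    D = <<[set a; b]%SET>>%g :> {set gT} -> image_sub1 to f = image_sub1 to (a * b)%g.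
  move=> oa ob DE; have [aD bD] := generators_mem DE.
  case: (dihedral8_order4 oa ob DE D_dihedral f_in_D f_order) => -> //.
  by rewrite image_sub1V // groupM.
have [b b_bij] := L_free.
have tf (v : L) : v *+ 2 = 0 -> v = 0.
  have [b' _ b'K] := b_bij; rewrite -(b'K v) -raddfMn => bv0.
  suff -> : b' v = 0 by rewrite raddf0.
  have : b' v *+ 2 = 0 by apply: (bij_inj b_bij); rewrite bv0 raddf0.
  move/rowP=> E; apply/rowP => i; have /eqP := E i.
  by rewrite mulmxnE !mxE Num.Theory.mulrn_eq0 /= => /eqP.
have -> : (n + 3 * d + e - (2 * d + e + n) = d)%N by lia.
split=> //.
- rewrite (image_fE t u) // d_def; exact: index_Bgroup b_bij.
- rewrite (image_fE t u) // d_def; exact: image_sub1_f_eq b_bij.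
rewrite /commutator_density; split=> [dens|[a [c [oa oc /esym DE LE]]]].
  exists t, u; split=> //; apply: fixed_points_generate => //.
  by rewrite -(image_fE t u) // -dens -(commutator_subgroup_gen to_additive D_gen).
have [aD cD] := generators_mem DE.
have image_caE : image_sub1 to (c * a)%g = image_sub1 to f.
  by rewrite (image_fE a c) // -(image_sub1V to_additive (groupM aD cD)) invMg !invg2id.
rewrite (commutator_subgroup_gen to_additive DE).
apply/seteqP; split; last by rewrite (image_fE a c) //; exact: image_sub1M.
move=> _ [x Ix [y Iy <-]]; apply: subgroupD.
- exact: subgroup_image_sub1.
- rewrite -image_caE; exact: (image_sub1_fixed_points to_additive aD cD LE).
rewrite (image_fE a c) //; apply: (image_sub1_fixed_points to_additive cD aD) => //.
rewrite LE; apply/seteqP; split=> _ [v va [w wc <-]];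
  by exists w => //; exists v => //; rewrite addrC.
Qed.
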